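(* In the (universal) hyperbolic plane with absolute conic $\mathcal{N}\colon x_1^2+x_2^2-x_0^2=0$, let $$\mathcal{C}\colon \lambda(x_1^2+x_2^2-x_0^2)+(x_2-x_0)^2=0,\qquad \lambda\in\mathbb{R}\setminus\{0\},$$ be a horocycle. Then the Frégier locus of $\mathcal{C}$ is the conic $$\mathcal{F}\colon \lambda(x_1^2+x_2^2-x_0^2)+5(x_2-x_0)^2=0,$$ that is, $\mathcal{C}$ and $\mathcal{F}$ are related by the map $\lambda\mapsto\frac15\lambda$. In particular, the Frégier locus of a horocycle is never singular.
   Context: Points have homogeneous coordinates $[x_0,x_1,x_2]$; points inside and outside $\mathcal{N}$ are treated equally, and the Frégier locus is considered in the complex projective plane. Two lines are orthogonal if they are conjugate with respect to $\mathcal{N}$ (one contains the pole of the other with respect to $\mathcal{N}$). A conic is regular if its symmetric coefficient matrix is invertible. A horocycle is a regular conic $\mathcal{C}$ such that all four intersection points of $\mathcal{C}$ and $\mathcal{N}$ coincide. For a regular conic $\mathcal{C}$ and $p\in\mathcal{C}$, the Frégier point $f(\mathcal{C},p)$ is the point common to the hypotenuses $q\vee r$ of all right triangles $p,q,r$ inscribed into $\mathcal{C}$ with right angle at $p$; equivalently, it is the pole with respect to $\mathcal{C}$ of the line joining the second intersection points with $\mathcal{C}$ of the two (possibly complex) tangents of $\mathcal{N}$ through $p$ (if these second intersection points coincide, the line is the tangent of $\mathcal{C}$ there; in particular $f(\mathcal{C},p)=p$ if $\mathcal{C}$ and $\mathcal{N}$ are tangent at $p$). The Frégier locus is $\mathcal{F}=\{f(\mathcal{C},p)\mid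 p\in\mathcal{C}\}$; it is called singular if it is not a regular conic. *)

(* Defs.v *)
From mathcomp Require Import all_boot all_order all_algebra.
From mathcomp Require Import ring.
From mathcomp Require Import boolp classical_sets reals.
From mathcomp Require Import complex.

Set Implicit Arguments.
Unset Strict Implicit.
Unset Printing Implicit Defensive.

Import GRing.Theory.
Local Open Scope ring_scope.
Local Open Scope classical_set_scope.

(* Points and lines of the projective plane over K are nonzero row vectors in
   'rV[K]_3, taken up to a nonzero factor.  Two such vectors x and y represent
   the same point (or line) iff they span the same subspace, (x == y)%MS.
   Conics are given by symmetric matrices A, with equation x A x^T = 0. *)
Section ConicsAndFregierPoints.

Variable K : fieldType.
Implicit Types (A : 'M[K]_3) (x p q r f g l m h : 'rV[K]_3).

Definition incident x l : Prop := (x *m l^T) 0 0 = 0.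

Definition qform A x : K := (x *m A *m x^T) 0 0.

Definition conic A : set 'rV[K]_3 := [set x | x != 0 /\ qform A x = 0].

Definition regular A : Prop := A^T = A /\ A \in unitmx.

Definition tangent A x : 'rV[K]_3 := x *m A.

Definition pole A l : 'rV[K]_3 := l *m invmx A.

(* x1^2 + x2^2 - x0^2 = 0 *)
Definition absolute : 'M[K]_3 :=
  diag_mx (\row_(j < 3) (if j == 0 then -1 else 1)).

Definition orthogonal l m : Prop := incident (pole absolute l) m.

(* l is the line joining the points q and r of the conic A, where the join of
   q with itself is the tangent of A at q.  Equivalently, r is the second
   intersection point with A of the line l through q, with r = q precisely
   when l is tangent to A at q. *)
Definition join A q r l : Prop :=
  [/\ l != 0, incident q l, incident r l & (q == r)%MS -> (l == tangent A q)%MS].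

(* p, q, r is a triangle inscribed into the conic A, with right angle at p.
   Vertices are allowed to coincide, the corresponding side then being a
   tangent of A; otherwise there would be no right triangle at all when p is a
   point of contact of A and the absolute conic, while these limiting
   triangles yield p as the Fregier point, as they should. *)
Definition right_triangle A p q r : Prop :=
  [/\ conic A p, conic A q, conic A r &
      exists l m, [/\ join A p q l, join A p r m & orthogonal l m]].

Definition hypotenuse A p h : Prop :=
  exists q r, right_triangle A p q r /\ join A q r h.

(* f is the one and only point common to all hypotenuses. *)
Definition is_fregier_point A p f : Prop :=
  f != 0 /\
  forall g, g != 0 ->
    ((forall h, hypotenuse A p h -> incident g h) <-> (g == f)%MS).

Definition fregier_locus A : set 'rV[K]_3 :=
  [set f | exists p, conic A p /\ is_fregier_point A p f].

Definition singular (S : set 'rV[K]_3) : Prop :=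
  ~ exists A, regular A /\ S = conic A.

(* The parametrization of the absolute conic by the projective line. *)
Definition absolute_point (s t : K) : 'rV[K]_3 :=
  \row_(j < 3) (if j == 0 then s ^+ 2 + t ^+ 2
                else if j == 1 then (s * t) *+ 2 else s ^+ 2 - t ^+ 2).

(* The intersection points of A with the absolute conic, counted with
   multiplicity, are the roots [s, t] of the binary quartic form
   qform A (absolute_point s t).  All four of them coincide iff this form is a
   nonzero multiple of the fourth power of a linear form. *)
Definition horocycle A : Prop :=
  regular A /\
  exists a b c : K, [/\ (a, b) != (0, 0), c != 0 &
    forall s t, qform A (absolute_point s t) = c * (b * s - a * t) ^+ 4].

(* x2 - x0 *)
Definition horocycle_tangent : 'rV[K]_3 :=
  \row_(j < 3) (if j == 0 then -1 else if j == 1 then 0 else 1).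

Definition horocycle_mx (lambda : K) : 'M[K]_3 :=
  lambda *: absolute + horocycle_tangent^T *m horocycle_tangent.

Lemma horocycle_mxE lambda x :
  qform (horocycle_mx lambda) x =
  lambda * (x 0 1 ^+ 2 + x 0 2 ^+ 2 - x 0 0 ^+ 2) + (x 0 2 - x 0 0) ^+ 2.
Proof.
rewrite /qform !mxE !big_ord_recl big_ord0 !mxE !big_ord_recl !big_ord0 !mxE /=.
rewrite !big_ord1 !mxE /=.
have -> : lift ord0 ord0 = 1 :> 'I_3 by apply/val_inj.
have -> : lift ord0 (lift ord0 ord0) = 2 :> 'I_3 by apply/val_inj.
by rewrite ?mulr1n ?mulr0n /=; ring.
Qed.

Lemma absoluteE x :
  qform absolute x = x 0 1 ^+ 2 + x 0 2 ^+ 2 - x 0 0 ^+ 2.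
Proof.
rewrite /qform !mxE !big_ord_recl big_ord0 !mxE !big_ord_recl !big_ord0 !mxE /=.
have -> : lift ord0 ord0 = 1 :> 'I_3 by apply/val_inj.
have -> : lift ord0 (lift ord0 ord0) = 2 :> 'I_3 by apply/val_inj.
by rewrite ?mulr1n ?mulr0n /=; ring.
Qed.

Lemma absolute_point_conic s t : qform absolute (absolute_point s t) = 0.
Proof.
rewrite /qform !mxE !big_ord_recl big_ord0 !mxE !big_ord_recl !big_ord0 !mxE /=.
by rewrite ?mulr1n ?mulr0n /=; ring.
Qed.

Lemma absolute_point_surj x : (2 : K) != 0 -> conic absolute x ->
  exists s t, (s, t) != (0, 0) /\ (x == absolute_point s t)%MS.
Proof.
move=> K2 [x0]; rewrite absoluteE => qx.
have rowP3 (u v : 'rV[K]_3) : u 0 0 = v 0 0 -> u 0 1 = v 0 1 -> u 0 2 = v 0 2 -> u = v.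
  move=> h0 h1 h2; apply/rowP => -[[|[|[|//]]] lt3].
  - by rewrite (_ : Ordinal lt3 = 0) //; apply/val_inj.
  - by rewrite (_ : Ordinal lt3 = 1) //; apply/val_inj.
  - by rewrite (_ : Ordinal lt3 = 2) //; apply/val_inj.
have scaled (u v : 'rV[K]_3) k : k != 0 -> k *: u = v -> (u == v)%MS.
  by move=> k0 <-; apply/eqmxP/eqmx_sym/eqmx_scale.
have [xs|xs] := eqVneq (x 0 0 + x 0 2) 0.
  have x2E : x 0 2 = - x 0 0 by apply/eqP; rewrite eq_sym -subr_eq0 -opprD oppr_eq0 xs.
  have x1E : x 0 1 = 0.
    by move: qx; rewrite x2E sqrrN addrK => /eqP; rewrite sqrf_eq0 => /eqP.
  have x00 : x 0 0 != 0.
    apply: contraNneq x0 => x00; apply/eqP/rowP3; rewrite ?mxE //.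
    by rewrite x2E x00 oppr0.
  exists 0, 1; split; first by rewrite xpair_eqE oner_eq0 andbF.
  apply: (scaled _ _ (x 0 0)^-1); rewrite ?invr_eq0 //.
  by apply: rowP3; rewrite !mxE /= ?x1E ?x2E; field.
exists (x 0 0 + x 0 2), (x 0 1); split; first by rewrite xpair_eqE (negPf xs).
apply: (scaled _ _ (2 * (x 0 0 + x 0 2))); first by rewrite mulf_neq0.
have x1E : x 0 1 ^+ 2 = x 0 0 ^+ 2 - x 0 2 ^+ 2.
  by apply/eqP; rewrite -subr_eq0 opprB addrA qx.
by apply: rowP3; rewrite !mxE /= ?x1E; ring.
Qed.

End ConicsAndFregierPoints.

(* Main.v *)
Require Import Defs.
From mathcomp Require Import all_boot all_order all_algebra.
From mathcomp Require Import ring.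
From mathcomp Require Import boolp classical_sets reals.
From mathcomp Require Import complex.

Set Implicit Arguments.
Unset Strict Implicit.
Unset Printing Implicit Defensive.

Import GRing.Theory.
Local Open Scope ring_scope.
Local Open Scope complex_scope.
Local Open Scope classical_set_scope.

(** Let N be the absolute conic, <.,.> its polar form, and let
    lam * <x, x> + mu * <u, x>^2 = 0 be a horocycle with contact point u, so
    <u, u> = 0.  Its Fregier point at p is p - (2 mu / lam) <u, p> u.  This
    map is inverted by f |-> f + (2 mu / lam) <u, f> u, and carries the
    horocycle onto the one with 5 mu in place of mu.

    To find the Fregier point, scale u so that <p, u> = 1 and use p, u and the
    pole w of their join as a basis: the horocycle becomes 2xy + z^2 = 0, and
    the line (0 : y : z) through p meets it again in (-y^2 : 2z^2 : -2yz). *)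

(** * Fregier points for an arbitrary absolute conic, and their behaviour under change of basis *)

Section RelativeFregierPoints.

Variable K : fieldType.
Implicit Types (N A G : 'M[K]_3) (x y p q r f g l m h : 'rV[K]_3).

(** A change of basis moves the absolute conic, so the notions are restated with [N] as a parameter;
    for [absolute K] they unfold to the original ones. *)
Definition orthogonal_wrt N l m : Prop := incident (pole N l) m.

Definition right_triangle_wrt N A p q r : Prop :=
  [/\ conic A p, conic A q, conic A r &
      exists l m, [/\ join A p q l, join A p r m & orthogonal_wrt N l m]].

Definition hypotenuse_wrt N A p h : Prop :=
  exists q r, right_triangle_wrt N A p q r /\ join A q r h.

Definition fregier_point_wrt N A p f : Prop :=
  f != 0 /\
  forall g, g != 0 ->
    ((forall h, hypotenuse_wrt N A p h -> incident g h) <-> (g == f)%MS).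

(** Convention for what follows: if [x] holds coordinates in the basis formed by the rows of [G],
    the point is [x *m G]; a line [l] gets the coordinates [l *m G^T] and a conic [A] the Gram
    matrix [G *m A *m G^T]. *)
Lemma incident_mul G x l : incident (x *m G) l <-> incident x (l *m G^T).
Proof. by rewrite /incident trmx_mul trmxK mulmxA. Qed.

Lemma incident_scale (k : K) x l : incident x l -> incident (k *: x) l.
Proof. by rewrite /incident -scalemxAl => e; rewrite mxE e mulr0. Qed.

Lemma qform_mul G A x : qform A (x *m G) = qform (G *m A *m G^T) x.
Proof. by rewrite /qform trmx_mul !mulmxA. Qed.

Section ChangeOfBasis.

Variable G : 'M[K]_3.
Hypothesis uG : G \in unitmx.

Let uGT : G^T \in unitmx. Proof. by rewrite unitmx_tr. Qed.

Lemma mul_unit_eq0 n (B : 'M[K]_n) (x : 'rV[K]_n) :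
  B \in unitmx -> (x *m B == 0) = (x == 0).
Proof.
move=> uB; apply/eqP/eqP => [xB0|->]; last by rewrite mul0mx.
by rewrite -(mulmxK uB x) xB0 mul0mx.
Qed.

Lemma eqmx_mul_unit n (B : 'M[K]_n) (x y : 'rV[K]_n) :
  B \in unitmx -> (x *m B == y *m B)%MS = (x == y)%MS.
Proof. by move=> uB; rewrite !submxMfree ?row_free_unit. Qed.

Lemma conic_mul A x : conic A (x *m G) <-> conic (G *m A *m G^T) x.
Proof. by rewrite /conic /= qform_mul mul_unit_eq0. Qed.

Lemma join_mul A q r l :
  join A (q *m G) (r *m G) l <-> join (G *m A *m G^T) q r (l *m G^T).
Proof.
rewrite /join mul_unit_eq0 // eqmx_mul_unit //.
rewrite -(eqmx_mul_unit l (tangent A _) uGT) /tangent !mulmxA.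
by split=> -[? /incident_mul ? /incident_mul ? ?]; split.
Qed.

(** Poles transform like points: in the pole with respect to [G *m N *m G^T] the outer factors of
    the inverse cancel against [G^T] and [G]. *)
Lemma orthogonal_wrt_mul N l m : N \in unitmx ->
  orthogonal_wrt N l m <->
  orthogonal_wrt (G *m N *m G^T) (l *m G^T) (m *m G^T).
Proof.
move=> uN; rewrite /orthogonal_wrt -incident_mul.
suff -> : pole (G *m N *m G^T) (l *m G^T) *m G = pole N l by [].
have uM : G *m N *m G^T \in unitmx by rewrite !unitmx_mul uG uN.
rewrite -[LHS](mulmxK uN); congr (_ *m _).
by rewrite -[LHS](mulmxK uGT) /pole -2!(mulmxA (l *m G^T *m _)) mulmxKV // mulmxK.
Qed.

Lemma right_triangle_wrt_mul N A p q r : N \in unitmx ->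
  right_triangle_wrt N A (p *m G) (q *m G) (r *m G) <->
  right_triangle_wrt (G *m N *m G^T) (G *m A *m G^T) p q r.
Proof.
move=> uN; split=> -[/conic_mul ? /conic_mul ? /conic_mul ? [l [m [j1 j2 o]]]].
  split=> //; exists (l *m G^T), (m *m G^T).
  split; [exact/join_mul|exact/join_mul|].
  exact: (iffLR (orthogonal_wrt_mul _ _ uN)).
split=> //; exists (l *m invmx G^T), (m *m invmx G^T).
split; [apply/join_mul|apply/join_mul|apply: (iffRL (orthogonal_wrt_mul _ _ uN))];
  by rewrite !mulmxKV.
Qed.

Lemma hypotenuse_wrt_mul N A p h : N \in unitmx ->
  hypotenuse_wrt N A (p *m G) h <->
  hypotenuse_wrt (G *m N *m G^T) (G *m A *m G^T) p (h *m G^T).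
Proof.
move=> uN; split=> -[q [r [T j]]]; last first.
  exists (q *m G), (r *m G).
  by split; [apply/right_triangle_wrt_mul|apply/join_mul].
exists (q *m invmx G), (r *m invmx G); split.
  by apply/right_triangle_wrt_mul => //; rewrite !mulmxKV.
by apply/join_mul; rewrite !mulmxKV.
Qed.

(** Carries a Fregier point computed in a convenient frame back to the original coordinates. *)
Lemma fregier_point_wrt_mul N A p f : N \in unitmx ->
  fregier_point_wrt (G *m N *m G^T) (G *m A *m G^T) p f ->
  fregier_point_wrt N A (p *m G) (f *m G).
Proof.
move=> uN [f0 H]; split; first by rewrite mul_unit_eq0.
move=> g; rewrite -(mulmxKV uG g) mul_unit_eq0 // eqmx_mul_unit //.
move: (g *m invmx G) => {}g g0; rewrite -(H g g0); split=> Hh h.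
  rewrite -(mulmxKV uGT h) => /hypotenuse_wrt_mul hyp.
  by apply/incident_mul/Hh/hyp.
by move/hypotenuse_wrt_mul => hyp; apply/incident_mul/Hh/hyp.
Qed.

End ChangeOfBasis.

End RelativeFregierPoints.

(** * Explicit coordinates for vectors and matrices of size three *)

Section Coordinates.

Variable K : fieldType.
Implicit Types (x y z : K) (u v w : 'rV[K]_3).

Definition row3 x y z : 'rV[K]_3 :=
  \row_(j < 3) (if j == 0 then x else if j == 1 then y else z).

Definition mx3 u v w : 'M[K]_3 :=
  \matrix_(i < 3) (if i == 0 then u else if i == 1 then v else w).

(** Case analysis that leaves the literals [0], [1], [2], so that the tests [j == 0] and [j == 1] in
    the definitions compute. *)
Lemma ord3P (P : 'I_3 -> Prop) : P 0 -> P 1 -> P 2 -> forall i, P i.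
Proof.
move=> P0 P1 P2 [[|[|[|//]]] lt3].
- by rewrite (_ : Ordinal lt3 = 0) //; apply/val_inj.
- by rewrite (_ : Ordinal lt3 = 1) //; apply/val_inj.
- by rewrite (_ : Ordinal lt3 = 2) //; apply/val_inj.
Qed.

Lemma sum3 (V : nmodType) (F : 'I_3 -> V) : \sum_i F i = F 0 + F 1 + F 2.
Proof.
rewrite !big_ord_recl big_ord0 addr0 addrA.
have -> : lift ord0 ord0 = 1 :> 'I_3 by apply/val_inj.
by have -> : lift ord0 (lift ord0 ord0) = 2 :> 'I_3 by apply/val_inj.
Qed.

Lemma row3_inj v w :
  v 0 0 = w 0 0 -> v 0 1 = w 0 1 -> v 0 2 = w 0 2 -> v = w.
Proof. by move=> e0 e1 e2; apply/rowP; apply: ord3P. Qed.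

Lemma row3E v : v = row3 (v 0 0) (v 0 1) (v 0 2).
Proof. by apply: row3_inj; rewrite !mxE. Qed.

Lemma row3P v : exists x y z, v = row3 x y z.
Proof. by exists (v 0 0), (v 0 1), (v 0 2); apply: row3E. Qed.

Lemma row3_eq0 x y z : (row3 x y z == 0) = [&& x == 0, y == 0 & z == 0].
Proof.
apply/eqP/and3P => [/rowP e|[/eqP-> /eqP-> /eqP->]].
  by move: (e 0) (e 1) (e 2); rewrite !mxE /= => -> -> ->.
by apply: row3_inj; rewrite !mxE.
Qed.

Lemma scale_row3 c x y z : c *: row3 x y z = row3 (c * x) (c * y) (c * z).
Proof. by apply: row3_inj; rewrite !mxE. Qed.

Lemma add_row3 x y z x' y' z' :
  row3 x y z + row3 x' y' z' = row3 (x + x') (y + y') (z + z').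
Proof. by apply: row3_inj; rewrite !mxE. Qed.

Lemma row3_eq x y z x' y' z' :
  row3 x y z = row3 x' y' z' -> [/\ x = x', y = y' & z = z'].
Proof. by move=> /rowP e; move: (e 0) (e 1) (e 2); rewrite !mxE. Qed.

Lemma incident3 x y z x' y' z' :
  incident (row3 x y z) (row3 x' y' z') <-> x * x' + y * y' + z * z' = 0.
Proof. by rewrite /incident !mxE sum3 !mxE. Qed.

Lemma mul_row3_mx3 x y z u v w :
  row3 x y z *m mx3 u v w = x *: u + y *: v + z *: w.
Proof. by apply/rowP => j; rewrite !mxE sum3 !mxE. Qed.

Lemma eqmx_rowP v w : (v == w)%MS -> v != 0 -> exists2 k, k != 0 & v = k *: w.
Proof.
move=> /andP[/sub_rVP[k vE] _] v0; exists k => //.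
by apply: contraNneq v0 => k0; rewrite vE k0 scale0r.
Qed.

Lemma scale_eqmx k v : k != 0 -> (k *: v == v)%MS.
Proof. by move=> k0; apply/eqmxP/eqmx_scale. Qed.

Lemma eqmx_scalel k v w : k != 0 -> (k *: v == w)%MS = (v == w)%MS.
Proof. by move=> k0; rewrite !(eqmx_scale _ k0). Qed.

End Coordinates.

(** * Fregier points in the normal form *)

Section NormalForm.

Variable K : fieldType.
Implicit Types (x y z mu lam : K) (f g h l m p q r : 'rV[K]_3).

(* The Gram matrix of N in the basis p, u, w, where <p, p> = - mu.  The
   horocycle has the matrix lam *: null_gram 0 in this basis. *)
Definition null_gram mu : 'M[K]_3 :=
  mx3 (row3 (- mu) 1 0) (row3 1 0 0) (row3 0 0 1).

Lemma mul_null_gram mu x y z :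
  row3 x y z *m null_gram mu = row3 (y - mu * x) x z.
Proof.
rewrite mul_row3_mx3 !scale_row3 !add_row3.
by apply: row3_inj; rewrite !mxE /=; ring.
Qed.

(** The determinant is -1 for every [mu], so the inverse is polynomial in [mu]; it makes poles
    explicit. *)
Lemma null_gram_mulV mu :
  null_gram mu *m mx3 (row3 0 1 0) (row3 1 mu 0) (row3 0 0 1) = 1%:M.
Proof.
apply/row_matrixP; apply: ord3P; rewrite row_mul rowK /= mul_row3_mx3;
  rewrite !scale_row3 !add_row3; apply: row3_inj; rewrite !mxE /=; ring.
Qed.

Lemma null_gram_unit mu : null_gram mu \in unitmx.
Proof. by have [] := mulmx1_unit (null_gram_mulV mu). Qed.

Lemma pole_null_gram mu x y z :
  pole (null_gram mu) (row3 x y z) = row3 y (x + mu * y) z.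
Proof.
have -> : pole (null_gram mu) (row3 x y z) =
    row3 x y z *m mx3 (row3 0 1 0) (row3 1 mu 0) (row3 0 0 1).
  by rewrite /pole -[invmx _]mulmx1 -(null_gram_mulV mu) mulKmx ?null_gram_unit.
rewrite mul_row3_mx3 !scale_row3 !add_row3.
by apply: row3_inj; rewrite !mxE /=; ring.
Qed.

Lemma orthogonal_null_gram mu x y z x' y' z' :
  orthogonal_wrt (null_gram mu) (row3 x y z) (row3 x' y' z') <->
  y * x' + (x + mu * y) * y' + z * z' = 0.
Proof. by rewrite /orthogonal_wrt pole_null_gram; apply: incident3. Qed.

Lemma tangent_null_gram lam x y z :
  tangent (lam *: null_gram 0) (row3 x y z) = lam *: row3 y x z.
Proof. by rewrite /tangent -scalemxAr mul_null_gram mul0r subr0. Qed.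

Lemma conic_null_gram lam x y z : lam != 0 ->
  conic (lam *: null_gram 0) (row3 x y z) <->
  ~~ [&& x == 0, y == 0 & z == 0] /\ 2 * x * y + z ^+ 2 = 0.
Proof.
move=> lam0; rewrite /conic /= row3_eq0 /qform.
rewrite -/(tangent _ _) tangent_null_gram scale_row3.
suff -> : (row3 (lam * y) (lam * x) (lam * z) *m (row3 x y z)^T) 0 0 =
    lam * (2 * x * y + z ^+ 2).
  split=> -[-> e]; split=> //; last by rewrite e mulr0.
  by move/eqP: e; rewrite mulf_eq0 (negPf lam0) => /eqP.
by rewrite !mxE sum3 !mxE /=; ring.
Qed.

Hypothesis K2 : (2 : K) != 0.

(** Away from [row3 1 0 0], incidence with the line gives the ratio of the last two coordinates of
    [q], and the equation of the conic gives the first one. *)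
Lemma second_intersection lam q x y z : lam != 0 ->
  conic (lam *: null_gram 0) q ->
  join (lam *: null_gram 0) (row3 1 0 0) q (row3 x y z) ->
  [/\ x = 0, (y != 0) || (z != 0) &
      exists2 k, k != 0 & q = k *: row3 (- y ^+ 2) (2 * z ^+ 2) (- 2 * y * z)].
Proof.
move=> lam0; have [a [b [c ->]]] := row3P q.
move=> /(conic_null_gram _ _ _ lam0)[q0 qE] [l0 /incident3 + /incident3].
rewrite !mul0r mul1r !addr0 => x0; move: l0; rewrite {}x0 mulr0 add0r => l0 lq T.
have {}l0 : (y != 0) || (z != 0).
  by move: l0; rewrite row3_eq0 eqxx /= negb_and.
(* If [b = 0], then [q] is [row3 1 0 0] again and [join] forces the tangent, [z = 0]; the formula
   covers this case too. *)
split=> //; have [b0|b0] := eqVneq b 0.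
  have c0 : c = 0 by move/eqP: qE; rewrite b0 mulr0 add0r sqrf_eq0 => /eqP.
  move: q0 T; rewrite b0 c0 eqxx !andbT => a0 T.
  have e : (row3 1 0 0 == row3 a 0 0)%MS.
    by rewrite -(eqmx_scalel _ _ a0) scale_row3 mulr1 mulr0 submx_refl.
  move: (T e); rewrite tangent_null_gram => /eqmx_rowP[|k k0].
    by rewrite row3_eq0 eqxx /= negb_and.
  rewrite !scale_row3 !mulr0 => /row3_eq[_ _ z0].
  move: l0; rewrite z0 eqxx orbF => y0.
  exists (- a / y ^+ 2); first by rewrite mulf_neq0 ?oppr_eq0 ?invr_eq0 ?expf_neq0.
  by rewrite scale_row3; congr row3; field.
have z0 : z != 0.
  apply: contraNneq b0 => z0; move: lq l0.
  rewrite z0 eqxx orbF mulr0 addr0 => /eqP; rewrite mulf_eq0.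
  by case/orP=> [//|/eqP->]; rewrite eqxx.
exists (b / (2 * z ^+ 2)).
  by rewrite mulf_neq0 ?invr_eq0 ?mulf_neq0 ?expf_neq0.
have cE : c = - (b * y / z).
  apply: (mulIf z0); rewrite mulNr divfK //; apply/eqP.
  by rewrite -addr_eq0 addrC lq.
rewrite scale_row3; congr row3; try by field; rewrite ?K2 ?z0.
  apply: (mulfI (mulf_neq0 K2 b0)).
  have -> : 2 * b * a = - c ^+ 2.
    by apply/eqP; rewrite -addr_eq0 -qE; apply/eqP; ring.
  by rewrite cE; field; rewrite ?K2 ?z0.
by rewrite cE; field; rewrite ?K2 ?z0.
Qed.

(** Orthogonality of the legs reads [mu * y * y' + z * z' = 0], so one leg determines the other up
    to a factor [t]. A combination of the incidences of [q] and [r] with [h] then gives the claim,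
    unless a leg is orthogonal to itself. *)
Lemma hypotenuse_generic mu lam h : mu != 0 -> lam != 0 ->
  hypotenuse_wrt (null_gram mu) (lam *: null_gram 0) (row3 1 0 0) h ->
  incident (row3 1 (- 2 * mu) 0) h.
Proof.
move=> mu0 lam0 [q [r [[_ Cq Cr [l [m [jl jm o]]]] [_ hq hr T]]]].
move: jl jm o hq hr T.
have [x [y [z ->]]] := row3P l; have [x' [y' [z' ->]]] := row3P m.
move=> /(second_intersection lam0 Cq)[-> yz0 [k k0 ->]].
move=> /(second_intersection lam0 Cr)[-> yz0' [k' k0' ->]].
have [h0 [h1 [h2 ->]]] := row3P h.
move=> /orthogonal_null_gram; rewrite mulr0 !add0r => o.
rewrite !scale_row3 !incident3 => hq hr T.
have {}hq : - y ^+ 2 * h0 + 2 * z ^+ 2 * h1 - 2 * y * z * h2 = 0.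
  by apply: (mulfI k0); rewrite mulr0 -hq; ring.
have {}hr : - y' ^+ 2 * h0 + 2 * z' ^+ 2 * h1 - 2 * y' * z' * h2 = 0.
  by apply: (mulfI k0'); rewrite mulr0 -hr; ring.
have [t t0 [y'E z'E]] : exists2 t, t != 0 & y' = t * z /\ z' = - t * mu * y.
  have [z0|z0] := eqVneq z 0.
    move: yz0 yz0' o; rewrite z0 eqxx orbF mul0r addr0 => y0.
    move=> yz0' /eqP; rewrite !mulf_eq0 (negPf mu0) (negPf y0) /= => /eqP y'0.
    exists (- z' / (mu * y)); last first.
      by rewrite mulr0 y'0; split=> //; field; rewrite mu0 y0.
    move: yz0'; rewrite y'0 eqxx /= => z'0.
    by rewrite mulf_neq0 ?oppr_eq0 ?invr_eq0 ?mulf_neq0.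
  have z'E : z' = - (y' / z) * mu * y.
    by apply: (mulfI z0); apply/eqP; rewrite -subr_eq0 -o; apply/eqP; field.
  exists (y' / z); last by rewrite divfK.
  rewrite mulf_neq0 ?invr_eq0 //; apply: contraTneq yz0' => y'0.
  by rewrite z'E y'0 !(mul0r, oppr0) eqxx.
have [D0|D0] := eqVneq (mu * y ^+ 2 + z ^+ 2) 0; last first.
  apply: (mulfI D0); apply: (mulIf (expf_neq0 2 t0)).
  apply: oppr_inj; rewrite mulr0 mul0r oppr0.
  (* These weights cancel the terms in [h2]; what remains is [- t ^+ 2 * (mu * y ^+ 2 + z ^+ 2)]
     times [h0 - 2 * mu * h1]. *)
  transitivity (t ^+ 2 * mu *
      (- y ^+ 2 * h0 + 2 * z ^+ 2 * h1 - 2 * y * z * h2) +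
      (- y' ^+ 2 * h0 + 2 * z' ^+ 2 * h1 - 2 * y' * z' * h2)).
    by rewrite y'E z'E; ring.
  by rewrite hq hr mulr0 addr0.
have z0 : z != 0.
  apply: contraTneq yz0 => z0; move/eqP: D0; rewrite z0 expr0n addr0.
  by rewrite mulf_eq0 (negPf mu0) sqrf_eq0 eqxx orbF /= => ->.
have y0 : y != 0.
  apply: contraNneq z0 => y0; move/eqP: D0.
  by rewrite y0 expr0n mulr0 add0r sqrf_eq0.
have muE : mu = - (z / y) ^+ 2.
  apply: (mulIf (expf_neq0 2 y0)); apply/eqP; rewrite -subr_eq0 -D0.
  by apply/eqP; field.
(* A self-orthogonal leg is a tangent of N; then q and r coincide and the
   hypotenuse is the tangent of the conic at q. *)
have : (row3 (k * - y ^+ 2) (k * (2 * z ^+ 2)) (k * (- 2 * y * z)) ==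
        row3 (k' * - y' ^+ 2) (k' * (2 * z' ^+ 2)) (k' * (- 2 * y' * z')))%MS.
  rewrite -!scale_row3 eqmx_scalel //.
  (* The second leg is now [t * z / y] times the first, and the second intersection point is
     quadratic in the leg. *)
  have -> : row3 (- y' ^+ 2) (2 * z' ^+ 2) (- 2 * y' * z') =
      (t * z / y) ^+ 2 *: row3 (- y ^+ 2) (2 * z ^+ 2) (- 2 * y * z).
    by rewrite scale_row3 y'E z'E muE; congr row3; field.
  rewrite scalerA; apply/eqmxP/eqmx_sym/eqmx_scale.
  by rewrite mulf_neq0 ?expf_neq0 ?mulf_neq0 ?invr_eq0.
move/T; rewrite tangent_null_gram => /andP[/sub_rVP[c]] + _.
rewrite scale_row3 scale_row3 => /row3_eq[-> -> ->].
transitivity (2 * c * lam * k * (mu * y ^+ 2 + z ^+ 2)); first by ring.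
by rewrite D0 mulr0.
Qed.

(** Uniqueness needs only two hypotenuses meeting nowhere else: [row3 0 0 1] and
    [row3 (2 * mu) 1 (1 - mu)]. *)
Lemma fregier_point_generic mu lam : mu != 0 -> lam != 0 ->
  fregier_point_wrt (null_gram mu) (lam *: null_gram 0)
    (row3 1 0 0) (row3 1 (- 2 * mu) 0).
Proof.
move=> mu0 lam0.
have C0 : conic (lam *: null_gram 0) (row3 1 0 0).
  by apply/conic_null_gram; rewrite ?oner_eq0 //; split=> //; ring.
split; first by rewrite row3_eq0 oner_eq0.
move=> g g0; split=> [Hg|/eqmx_rowP[//|k k0 ->] h hyp]; last first.
  exact/incident_scale/(hypotenuse_generic mu0 lam0 hyp).
have [a [b [c gE]]] := row3P g.
have c0 : c = 0.
  (* A limiting triangle: one leg is the tangent at [row3 1 0 0], so one further vertex falls there,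
     and the orthogonal leg through the contact point [row3 0 1 0] is also the hypotenuse. *)
  suff /Hg : hypotenuse_wrt (null_gram mu) (lam *: null_gram 0) (row3 1 0 0)
      (row3 0 0 1).
    by rewrite gE incident3 !mulr0 !add0r mulr1.
  have ne : ~ (row3 (1 : K) 0 0 == row3 0 1 0)%MS.
    move/eqmx_rowP; rewrite row3_eq0 oner_eq0 => -[//|k _].
    by rewrite scale_row3 => /row3_eq[/eqP]; rewrite mulr0 oner_eq0.
  exists (row3 1 0 0), (row3 0 1 0); split; last first.
    by split; rewrite ?row3_eq0 ?oner_eq0 ?andbF ?incident3 ?mulr0 ?mul0r ?addr0.
  split=> //.
    by apply/conic_null_gram; rewrite ?oner_eq0 ?andbF //; split=> //; ring.
  exists (row3 0 1 0), (row3 0 0 1); split.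
  - split; rewrite ?row3_eq0 ?oner_eq0 ?andbF ?incident3 ?mulr0 ?mul0r ?addr0 //.
    by move=> _; rewrite tangent_null_gram; apply/eqmxP/eqmx_sym/eqmx_scale.
  - by split; rewrite ?row3_eq0 ?oner_eq0 ?andbF ?incident3 ?mulr0 ?mul0r ?addr0.
  - by apply/orthogonal_null_gram; ring.
(* The legs (0 : 1 : 1) and (0 : 1 : - mu) coincide when mu = - 1, and this
   hypotenuse is then a tangent. *)
have ab : 2 * mu * a + b = 0.
  suff /Hg : hypotenuse_wrt (null_gram mu) (lam *: null_gram 0) (row3 1 0 0)
      (row3 (2 * mu) 1 (1 - mu)).
    by rewrite gE incident3 c0 mul0r addr0 mulr1 mulrC.
  exists (row3 (- 1) 2 (- 2)), (row3 (- 1) (2 * mu ^+ 2) (2 * mu)); split; last first.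
    split; rewrite ?row3_eq0 ?oner_eq0 ?andbF ?incident3 //; try ring.
    move/eqmx_rowP; rewrite row3_eq0 oppr_eq0 oner_eq0 => -[//|k _].
    rewrite scale_row3 => /row3_eq[e1 _ e2].
    have k1 : k = 1 by apply: oppr_inj; rewrite e1; ring.
    have mu1 : mu = - 1.
      by apply: (mulfI K2); rewrite mulrN1 e2 k1 mul1r.
    rewrite tangent_null_gram mu1 scale_row3; apply/eqmxP.
    have -> : row3 (lam * 2) (lam * - 1) (lam * - 2) =
        - lam *: row3 (2 * - 1) 1 (1 - - 1) by rewrite scale_row3; congr row3; ring.
    by apply/eqmx_sym/eqmx_scale; rewrite oppr_eq0.
  split=> //.
  - by apply/conic_null_gram; rewrite ?oppr_eq0 ?oner_eq0 //; split=> //; ring.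
  - by apply/conic_null_gram; rewrite ?oppr_eq0 ?oner_eq0 //; split=> //; ring.
  have ne y z : z != 0 -> ~ (row3 (1 : K) 0 0 == row3 (- 1) y z)%MS.
    move=> z0 /eqmx_rowP; rewrite row3_eq0 oner_eq0 => -[//|k k0].
    rewrite scale_row3 => /row3_eq[_ _ /esym/eqP].
    by rewrite mulf_eq0 (negPf k0) (negPf z0).
  exists (row3 0 1 1), (row3 0 1 (- mu)); split.
  - split; rewrite ?row3_eq0 ?oner_eq0 ?andbF ?incident3 //; try ring.
    by move/ne; rewrite oppr_eq0 => /(_ K2).
  - split; rewrite ?row3_eq0 ?oner_eq0 ?andbF ?incident3 //; try ring.
    by move/ne; rewrite mulf_neq0 // => /(_ isT).
  - by apply/orthogonal_null_gram; ring.
have a0 : a != 0.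
  apply: contraNneq g0 => a0; move: ab; rewrite gE c0 a0 mulr0 add0r => ->.
  by rewrite row3_eq0 eqxx.
have -> : g = a *: row3 1 (- 2 * mu) 0.
  rewrite gE scale_row3 c0 mulr1 mulr0; congr row3.
  by apply/eqP; rewrite -subr_eq0 -ab; apply/eqP; ring.
exact: scale_eqmx.
Qed.

(** For lines through the contact point, orthogonality reduces to [z * z' = 0]. Hence one leg is the
    common tangent of the two conics, and its second vertex is the contact point itself, which
    therefore lies on the hypotenuse. *)
Lemma hypotenuse_contact mu lam h : lam != 0 ->
  hypotenuse_wrt (null_gram mu) (lam *: null_gram 0) (row3 0 1 0) h ->
  incident (row3 0 1 0) h.
Proof.
move=> lam0 [q [r [[_ Cq Cr [l [m [jl jm o]]]] [_ hq hr _]]]].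
have tangent_leg (s l' : 'rV[K]_3) : conic (lam *: null_gram 0) s ->
    join (lam *: null_gram 0) (row3 0 1 0) s l' -> l' 0 2 = 0 -> incident s h ->
    incident (row3 0 1 0) h.
  have [a [b [c ->]]] := row3P s; have [x [y [z ->]]] := row3P l'.
  have [h0 [h1 [h2 ->]]] := row3P h.
  move=> /(conic_null_gram _ _ _ lam0)[s0 sE] [l0 /incident3 + /incident3 + _].
  rewrite mul0r mul1r mul0r addr0 add0r [row3 x y z _ _]mxE /= => y0 sl z0.
  move: l0 sl; rewrite y0 z0 row3_eq0 eqxx !andbT !mulr0 !addr0 => x0 /eqP.
  rewrite mulf_eq0 (negPf x0) orbF => /eqP a0; move: s0 sE.
  rewrite a0 mulr0 mul0r add0r => + /eqP; rewrite sqrf_eq0 => + /eqP c0.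
  rewrite c0 eqxx andbT /= => b0.
  rewrite !incident3 !mul0r !add0r !addr0 mul1r => /eqP.
  by rewrite mulf_eq0 (negPf b0) => /eqP.
have : l 0 2 * m 0 2 = 0.
  move: jl jm o => [_ + _ _] [_ + _ _].
  have [x [y [z ->]]] := row3P l; have [x' [y' [z' ->]]] := row3P m.
  rewrite !incident3 !mul0r !mul1r !addr0 !add0r => -> ->.
  by rewrite orthogonal_null_gram !mxE /= mul0r mulr0 !add0r.
move/eqP; rewrite mulf_eq0 => /orP[]/eqP e.
  exact: (tangent_leg q l).
exact: (tangent_leg r m).
Qed.

(** For uniqueness, each chord through the contact point is a hypotenuse; the chords with [t = 0]
    and [t = 2] are distinct because 2 is invertible, and so meet only there. *)
Lemma fregier_point_contact mu lam : lam != 0 ->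
  fregier_point_wrt (null_gram mu) (lam *: null_gram 0) (row3 0 1 0) (row3 0 1 0).
Proof.
move=> lam0.
have C1 : conic (lam *: null_gram 0) (row3 0 1 0).
  by apply/conic_null_gram; rewrite ?oner_eq0 ?andbF //; split=> //; ring.
split; first by rewrite row3_eq0 oner_eq0 andbF.
have side s t : 2 * s + t ^+ 2 = 0 -> join (lam *: null_gram 0)
    (row3 0 1 0) (row3 1 s t) (row3 (- t) 0 1).
  move=> e; split; rewrite ?row3_eq0 ?oner_eq0 ?andbF ?incident3 //; try ring.
  move/eqmx_rowP; rewrite row3_eq0 oner_eq0 andbF => -[//|k k0].
  by rewrite scale_row3 mulr1 => /row3_eq[/esym/eqP]; rewrite (negPf k0).
(* The tangent leg is orthogonal to every line through the contact point, so the chord serves as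
   second leg and as hypotenuse. *)
have chord s t : 2 * s + t ^+ 2 = 0 -> hypotenuse_wrt (null_gram mu)
    (lam *: null_gram 0) (row3 0 1 0) (row3 (- t) 0 1).
  move=> e; exists (row3 0 1 0), (row3 1 s t); split; last exact: side.
  split=> //.
    by apply/conic_null_gram; rewrite ?oner_eq0 //; split=> //; rewrite -e; ring.
  exists (row3 1 0 0), (row3 (- t) 0 1); split; last 2 first.
  - exact: side.
  - by apply/orthogonal_null_gram; ring.
  split; rewrite ?row3_eq0 ?oner_eq0 ?incident3 //; try ring.
  by move=> _; rewrite tangent_null_gram; apply/eqmxP/eqmx_sym/eqmx_scale.
move=> g g0; split=> [Hg|/eqmx_rowP[//|k k0 ->] h hyp]; last first.
  exact/incident_scale/(hypotenuse_contact lam0 hyp).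
have [a [b [c gE]]] := row3P g.
have c0 : c = 0.
  have /(chord 0)/Hg : 2 * 0 + 0 ^+ 2 = 0 :> K by ring.
  by rewrite gE incident3 oppr0 !mulr0 !add0r mulr1.
have a0 : a = 0.
  have /(chord (- 2))/Hg : 2 * (- 2) + 2 ^+ 2 = 0 :> K by ring.
  rewrite gE incident3 c0 mul0r mulr0 !addr0 => /eqP.
  by rewrite mulrN oppr_eq0 mulf_eq0 (negPf K2) orbF => /eqP.
move: g0; rewrite gE a0 c0 row3_eq0 eqxx andbT /= => b0.
have -> : row3 0 b 0 = b *: row3 0 1 0 by rewrite scale_row3 mulr1 mulr0.
exact: scale_eqmx.
Qed.

End NormalForm.

(** * Horocycles without coordinates, null frames, and the Fregier locus *)

Section HorocycleLocus.

Variable K : fieldType.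
Implicit Types (A G : 'M[K]_3) (u v w x y f p : 'rV[K]_3) (lam mu k : K).

Definition hdot x y : K := (x *m absolute K *m y^T) 0 0.

Lemma hdotE x y :
  hdot x y = x 0 1 * y 0 1 + x 0 2 * y 0 2 - x 0 0 * y 0 0.
Proof. by rewrite /hdot !mxE sum3 !mxE !sum3 !mxE /= ?mulr1n ?mulr0n; ring. Qed.

Lemma hdotC x y : hdot x y = hdot y x.
Proof. by rewrite !hdotE; ring. Qed.

Lemma hdotDl x y w : hdot (x + y) w = hdot x w + hdot y w.
Proof. by rewrite !hdotE !mxE; ring. Qed.

Lemma hdotZl k x y : hdot (k *: x) y = k * hdot x y.
Proof. by rewrite !hdotE !mxE; ring. Qed.

Lemma hdotDr w x y : hdot w (x + y) = hdot w x + hdot w y.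
Proof. by rewrite hdotC hdotDl !(hdotC w). Qed.

Lemma hdotZr k x y : hdot x (k *: y) = k * hdot x y.
Proof. by rewrite hdotC hdotZl hdotC. Qed.

Definition hdot_linear := (hdotDl, hdotDr, hdotZl, hdotZr).

Lemma absolute_sym : (absolute K)^T = absolute K.
Proof. exact: tr_diag_mx. Qed.

Lemma absolute_mul : absolute K *m absolute K = 1%:M.
Proof.
rewrite mulmx_diag -diag_const_mx; congr diag_mx.
by apply: row3_inj; rewrite !mxE /= ?mulrNN mulr1.
Qed.

Lemma absolute_unit : absolute K \in unitmx.
Proof. by have [] := mulmx1_unit absolute_mul. Qed.

Lemma hdot_nondeg u : u != 0 -> exists v, hdot v u != 0.
Proof.
rewrite -(mul_unit_eq0 _ absolute_unit) => /rV0Pn[j uj].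
by exists (delta_mx 0 j); rewrite hdotC /hdot trmx_delta -colE mxE.
Qed.

(** For isotropic [u], the line [u *m absolute K] is the tangent of the absolute conic at [u]: the
    pencil is spanned by that conic and its doubled tangent. The coefficient [mu] absorbs rescalings
    of [u]. *)
Definition horocycle_form lam mu u : 'M[K]_3 :=
  lam *: absolute K + mu *: ((u *m absolute K)^T *m (u *m absolute K)).

Lemma qform_horocycle lam mu u x :
  qform (horocycle_form lam mu u) x = lam * hdot x x + mu * hdot u x ^+ 2.
Proof.
rewrite /qform /horocycle_form mulmxDr mulmxDl -!scalemxAr -!scalemxAl !mulmxA.
rewrite mxE [X in X + _]mxE [X in _ + X]mxE -/(hdot x x).
have -> : x *m (u *m absolute K)^T *m u *m absolute K *m x^T =
    (x *m (u *m absolute K)^T) *m (u *m absolute K *m x^T) by rewrite !mulmxA.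
rewrite expr2 [(_ *m (_ *m x^T)) _ _]mxE big_ord1; congr (_ + _ * (_ * _)).
by rewrite -hdotC /hdot trmx_mul absolute_sym mulmxA.
Qed.

Lemma horocycle_formZ lam mu k u :
  horocycle_form lam mu (k *: u) = horocycle_form lam (mu * k ^+ 2) u.
Proof.
rewrite /horocycle_form -!scalemxAl [(k *: _)^T]linearZ /= -scalemxAl -scalemxAr !scalerA.
by rewrite expr2 mulrA.
Qed.

Lemma horocycle_form_sym lam mu u :
  (horocycle_form lam mu u)^T = horocycle_form lam mu u.
Proof. by rewrite /horocycle_form linearD !linearZ /= trmx_mul trmxK absolute_sym. Qed.

(** The matrix is a rank-one update of [lam *: absolute K]. As [u] is isotropic, the product of the
    two rank-one terms vanishes, which leaves a polynomial correction in the inverse. *)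
Lemma horocycle_form_regular lam mu u : lam != 0 -> hdot u u = 0 ->
  regular (horocycle_form lam mu u).
Proof.
move=> lam0 uu; split; first exact: horocycle_form_sym.
have u_null : u *m absolute K *m u^T = 0.
  by apply/matrixP=> i j; rewrite !ord1 [RHS]mxE; exact: uu.
suff : horocycle_form lam mu u *m
    (lam^-1 *: absolute K - (mu / lam ^+ 2) *: (u^T *m u)) = 1%:M.
  by move/mulmx1_unit => [].
rewrite /horocycle_form mulmxBr !mulmxDl -!scalemxAl -!scalemxAr !scalerA.
rewrite absolute_mul divff // scale1r.
rewrite -(mulmxA _ (u *m _) (absolute K)) -(mulmxA u) absolute_mul mulmx1.
rewrite -(mulmxA _ (u *m _) (u^T *m u)) (mulmxA (u *m _)) u_null mul0mx mulmx0.
rewrite scaler0 addr0 trmx_mul absolute_sym -mulmxA.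
have -> : lam * (mu / lam ^+ 2) = mu / lam by field.
by rewrite mulrC addrK.
Qed.

Lemma gram_mx3 M u v w i j :
  (mx3 u v w *m M *m (mx3 u v w)^T) i j =
  (row i (mx3 u v w) *m M *m (row j (mx3 u v w))^T) 0 0.
Proof.
by rewrite tr_row -row_mul !mxE; apply: eq_bigr => k _;
  rewrite [in RHS]mxE [col _ _ _ _]mxE.
Qed.

(* w is the pole of the line p u, and <w, w> = <p, u>^2 - <p, p> <u, u>
   because det N = -1. *)
Lemma null_frame mu p u :
  hdot u u = 0 -> hdot p u = 1 -> hdot p p = - mu ->
  exists w, let G := mx3 p u w in
    G *m absolute K *m G^T = null_gram mu /\ u *m absolute K *m G^T = row3 1 0 0.
Proof.
move=> uu pu pp.
pose w := row3 (p 0 2 * u 0 1 - p 0 1 * u 0 2)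
  (p 0 2 * u 0 0 - p 0 0 * u 0 2) (p 0 0 * u 0 1 - p 0 1 * u 0 0).
have pw : hdot p w = 0 by rewrite hdotE !mxE /=; ring.
have uw : hdot u w = 0 by rewrite hdotE !mxE /=; ring.
have ww : hdot w w = 1.
  transitivity (hdot p u ^+ 2 - hdot p p * hdot u u); last first.
    by rewrite pu uu mulr0 subr0 expr1n.
  by rewrite !hdotE !mxE /=; ring.
exists w => G; have GE : G *m absolute K *m G^T = null_gram mu.
  apply/matrixP=> i j; rewrite gram_mx3 !rowK -/(hdot _ _).
  elim/ord3P: i; elim/ord3P: j; rewrite !mxE /= //.
  - by rewrite hdotC.
  - by rewrite hdotC.
  - by rewrite hdotC.
split=> //; have -> : u = row3 0 1 0 *m G.
  by rewrite mul_row3_mx3 !scale0r scale1r addr0 add0r.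
by rewrite -!mulmxA (mulmxA G) GE mul_null_gram mulr0 subr0.
Qed.

(** In the frame the doubled tangent is [x ^+ 2 = 0], and its weight [lam * mu] cancels the only
    entry of the Gram matrix that contains [mu]. *)
Lemma horocycle_form_frame lam mu u G :
  G *m absolute K *m G^T = null_gram mu -> u *m absolute K *m G^T = row3 1 0 0 ->
  G *m horocycle_form lam (lam * mu) u *m G^T = lam *: null_gram 0.
Proof.
move=> GE lE; rewrite /horocycle_form mulmxDr mulmxDl -!scalemxAr -!scalemxAl GE.
rewrite -scalerA -scalerDr; congr (_ *: _).
have -> : G *m ((u *m absolute K)^T *m (u *m absolute K)) *m G^T =
    (row3 1 0 0)^T *m row3 1 0 0.
  by rewrite -lE [in RHS]trmx_mul trmxK !mulmxA.
apply/matrixP=> i j; rewrite !mxE big_ord1 !mxE.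
by elim/ord3P: i; elim/ord3P: j; rewrite !mxE /=; ring.
Qed.

Lemma frame_unit G mu : G *m absolute K *m G^T = null_gram mu -> G \in unitmx.
Proof.
move=> GE; have := null_gram_unit mu.
by rewrite -GE unitmx_mul unitmx_tr => /andP[].
Qed.

Hypothesis K2 : (2 : K) != 0.

(** Adding [c *: u] to a vector [v1] with [hdot v1 u = 1] keeps this product and changes
    [hdot v1 v1] by [2 * c], which determines [c]. *)
Lemma exists_null_partner mu u : u != 0 -> hdot u u = 0 ->
  exists p, hdot p u = 1 /\ hdot p p = - mu.
Proof.
move=> u0 uu; have [v1 v1u] : exists v, hdot v u = 1.
  by have [v vu] := hdot_nondeg u0; exists ((hdot v u)^-1 *: v); rewrite hdotZl mulVf.
exists (v1 + (- (mu + hdot v1 v1) / 2) *: u).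
by rewrite !hdot_linear (hdotC u v1) uu v1u; split; [ring|field].
Qed.

(** A tangent of the absolute conic meets it only at its contact point: in a null frame the two
    equations become [x = 0] and [z ^+ 2 = 0]. *)
Lemma isotropic_colinear u p : u != 0 -> hdot u u = 0 ->
  hdot u p = 0 -> hdot p p = 0 -> exists k, p = k *: u.
Proof.
move=> u0 uu up pp; have [v [vu vv]] := exists_null_partner 0 u0 uu.
have [w [GE lE]] := null_frame uu vu vv.
have uG := frame_unit GE; move: up pp; rewrite -(mulmxKV uG p).
have [x [y [z ->]]] := row3P (p *m invmx (mx3 v u w)).
rewrite {1}/hdot trmx_mul mulmxA lE; move/incident3.
rewrite mul1r !mul0r !addr0 => ->.
rewrite -[hdot _ _]/(qform (absolute K) _) qform_mul GE /qform mul_null_gram.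
move=> /incident3; rewrite mulr0 mul0r !add0r => /eqP.
rewrite mulf_eq0 orbb => /eqP ->; exists y.
by rewrite mul_row3_mx3 !scale0r add0r addr0.
Qed.

Lemma horocycle_fregier_point lam mu u p :
  lam != 0 -> mu != 0 -> u != 0 -> hdot u u = 0 ->
  conic (horocycle_form lam mu u) p ->
  fregier_point_wrt (absolute K) (horocycle_form lam mu u) p
    (p - (2 * mu / lam * hdot u p) *: u).
Proof.
move=> lam0 mu0 u0 uu [p0]; rewrite qform_horocycle.
have [up|up] := eqVneq (hdot u p) 0.
  rewrite up expr0n !mulr0 addr0 scale0r subr0 => /eqP.
  rewrite mulf_eq0 (negPf lam0) => /eqP pp.
  have [k pE] := isotropic_colinear u0 uu up pp.
  have k0 : k != 0 by apply: contraNneq p0 => k0; rewrite pE k0 scale0r.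
  have -> : u = k^-1 *: p by rewrite pE scalerA mulVf ?scale1r.
  rewrite horocycle_formZ; set mu' := mu * _.
  (* Here [p] is the contact point. The value of [hdot v v] is chosen so that [horocycle_form_frame]
     applies. *)
  have [v [vp vv]] := exists_null_partner (mu' / lam) p0 pp.
  have [w [GE lE]] := null_frame pp vp vv; have uG := frame_unit GE.
  have pG : p = row3 0 1 0 *m mx3 v p w.
    by rewrite mul_row3_mx3 !scale0r scale1r addr0 add0r.
  rewrite {2 3}pG; apply: fregier_point_wrt_mul; rewrite ?absolute_unit //.
  have <- : lam * (mu' / lam) = mu' by rewrite mulrC divfK.
  rewrite (horocycle_form_frame lam GE lE) GE.
  exact: fregier_point_contact.
set c := hdot u p in up *; set u1 := c^-1 *: u => pE.
have u1u1 : hdot u1 u1 = 0 by rewrite !hdot_linear uu !mulr0.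
have pu1 : hdot p u1 = 1 by rewrite hdotZr hdotC mulVf.
have uE : u = c *: u1 by rewrite scalerA divff ?scale1r.
(* With [u1] scaled to [hdot p u1 = 1], the equation of the horocycle at [p] says exactly
   [hdot p p = - mu']. *)
pose mu' := mu * c ^+ 2 / lam.
have pp : hdot p p = - mu'.
  apply: (mulfI lam0); apply/eqP; rewrite -subr_eq0 -pE; apply/eqP.
  by rewrite /mu'; field.
have [w [GE lE]] := null_frame u1u1 pu1 pp; have uG := frame_unit GE.
have -> : p - (2 * mu / lam * c) *: u = row3 1 (- 2 * mu') 0 *m mx3 p u1 w.
  rewrite mul_row3_mx3 scale1r scale0r addr0 uE scalerA -scaleNr.
  by congr (_ + _ *: _); rewrite /mu'; field.
have {1}-> : p = row3 1 0 0 *m mx3 p u1 w.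
  by rewrite mul_row3_mx3 !scale0r scale1r !addr0.
rewrite uE horocycle_formZ.
have <- : lam * mu' = mu * c ^+ 2 by rewrite mulrC divfK.
apply: fregier_point_wrt_mul; rewrite ?absolute_unit //.
rewrite (horocycle_form_frame lam GE lE) GE.
by apply: fregier_point_generic => //; rewrite !mulf_neq0 ?invr_eq0 ?expf_neq0.
Qed.

(** For the Fregier point f of p, <u, f> = <u, p> and lam <f, f> = lam <p, p> - 4 mu <u, p>^2;
    moving the last term across turns [mu] into [5 * mu]. *)
Lemma fregier_locus_horocycle lam mu u :
  lam != 0 -> mu != 0 -> u != 0 -> hdot u u = 0 ->
  fregier_locus (horocycle_form lam mu u) = conic (horocycle_form lam (5 * mu) u).
Proof.
move=> lam0 mu0 u0 uu; apply/seteqP; split=> f.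
  move=> [p [Cp [f0 Hf]]]; have [_ H0] := horocycle_fregier_point lam0 mu0 u0 uu Cp.
  have /(H0 f f0)/eqmx_rowP[//|k k0 fE] :
      forall h, hypotenuse_wrt (absolute K) (horocycle_form lam mu u) p h ->
      incident f h.
    by apply/(Hf f f0); rewrite submx_refl.
  split=> //; case: Cp => _; rewrite fE !qform_horocycle => pE.
  rewrite -scaleNr !hdot_linear uu (hdotC p u).
  transitivity (k ^+ 2 * (lam * hdot p p + mu * hdot u p ^+ 2)); first by field.
  by rewrite pE mulr0.
move=> [f0]; rewrite qform_horocycle => fE.
pose p := f + (2 * mu / lam * hdot u f) *: u.
have up : hdot u p = hdot u f by rewrite !hdot_linear uu mulr0 addr0.
have pf : f = p - (2 * mu / lam * hdot u p) *: u by rewrite up addrK.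
have Cp : conic (horocycle_form lam mu u) p.
  split.
    apply: contraNneq f0 => p0; rewrite pf up -up p0.
    by rewrite hdotE !mxE !mulr0 !addr0 subr0 mulr0 scale0r subr0.
  rewrite qform_horocycle up !hdot_linear uu (hdotC f u).
  by rewrite -[RHS]fE; field.
exists p; split=> //; rewrite pf.
exact: horocycle_fregier_point.
Qed.

(** * Classification of horocycles by their quartic forms *)

Lemma vanishing_on_absolute A : (3 : K) != 0 -> A^T = A ->
  (forall s t, qform A (absolute_point s t) = 0) -> A = A 1 1 *: absolute K.
Proof.
move=> K3 symA A0.
have Asym i j : A j i = A i j by rewrite -[in LHS]symA mxE.
(* The coefficients of the quartic [qform A (absolute_point s t)], shown to vanish by evaluation at
   a few parameters. *)
pose e4 := A 0 0 + 2 * A 0 2 + A 2 2.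
pose e3 := 4 * (A 0 1 + A 1 2).
pose e2 := 2 * A 0 0 - 2 * A 2 2 + 4 * A 1 1.
pose e1 := 4 * (A 0 1 - A 1 2).
pose e0 := A 0 0 - 2 * A 0 2 + A 2 2.
have q s t : e4 * s ^+ 4 + e3 * s ^+ 3 * t + e2 * s ^+ 2 * t ^+ 2 +
    e1 * s * t ^+ 3 + e0 * t ^+ 4 = 0.
  rewrite -[RHS](A0 s t) /qform !mxE sum3 !mxE !sum3 !mxE /=.
  by rewrite (Asym 0 1) (Asym 0 2) (Asym 1 2) /e4 /e3 /e2 /e1 /e0; ring.
have e4E : e4 = 0 by rewrite -(q 1 0); ring.
have e0E : e0 = 0 by rewrite -(q 0 1); ring.
have {}q s t : e3 * s ^+ 3 * t + e2 * s ^+ 2 * t ^+ 2 + e1 * s * t ^+ 3 = 0.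
  by rewrite -(q s t) e4E e0E; ring.
have e2E : e2 = 0.
  apply: (mulfI K2); rewrite mulr0 -[RHS]addr0 -{1}(q 1 1) -(q 1 (- 1)); ring.
have e13 : e1 = - e3 by apply/eqP; rewrite -addr_eq0 -(q 1 1) e2E; apply/eqP; ring.
have e3E : e3 = 0.
  (* At [(2, 1)] the remaining form is [8 * e3 + 2 * e1 = 6 * e3]. *)
  have K6 : (6 : K) != 0 by rewrite (natrM _ 2 3) mulf_neq0.
  by apply: (mulfI K6); rewrite mulr0 -(q 2 1) e13 e2E; ring.
have e1E : e1 = 0 by rewrite e13 e3E oppr0.
have K4 : (4 : K) != 0 by rewrite (natrM _ 2 2) mulf_neq0.
have K8 : (8 : K) != 0 by rewrite (natrM _ 2 4) mulf_neq0.
have zero (k x : K) : k != 0 -> k * x = 0 -> x = 0.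
  by move=> k0 /eqP; rewrite mulf_eq0 (negPf k0) => /eqP.
have A02 : A 0 2 = 0.
  by apply: (zero 4) => //;
    transitivity (e4 - e0); [rewrite /e4 /e0; ring|rewrite e4E e0E subr0].
have A01 : A 0 1 = 0.
  by apply: (zero 8) => //;
    transitivity (e3 + e1); [rewrite /e3 /e1; ring|rewrite e3E e1E addr0].
have A12 : A 1 2 = 0.
  by apply: (zero 8) => //;
    transitivity (e3 - e1); [rewrite /e3 /e1; ring|rewrite e3E e1E subr0].
have A22 : A 2 2 = - A 0 0.
  apply/eqP; rewrite -addr_eq0; apply/eqP.
  by transitivity (e4 - 2 * A 0 2); [rewrite /e4; ring|rewrite e4E A02 mulr0 subr0].
have A00 : A 0 0 = - A 1 1.
  apply/eqP; rewrite -addr_eq0; apply/eqP; apply: (zero 4) => //.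
  by rewrite -e2E /e2 A22; ring.
apply/matrixP=> i j; rewrite !mxE; elim/ord3P: i; elim/ord3P: j;
  by rewrite ?(Asym 0 1) ?(Asym 0 2) ?(Asym 1 2) ?A01 ?A02 ?A12 ?A22 ?A00 ?mxE /=
    ?mulr0n ?mulr1n ?mulr0 ?mulr1 ?mulrN1 ?opprK.
Qed.

(** With [u] the point of parameter [(a, b)], the doubled tangent at [u] has as its quartic a
    multiple of [(b * s - a * t) ^+ 4]. Subtracting it with weight [c / 4] leaves a matrix vanishing
    on the absolute conic, hence a multiple of [absolute K]. *)
Lemma horocycle_formP A : (3 : K) != 0 -> horocycle A ->
  exists lam mu u, [/\ lam != 0, mu != 0, u != 0, hdot u u = 0 &
    A = horocycle_form lam mu u].
Proof.
move=> K3 [[symA unitA] [a [b [c [ab0 c0 Hq]]]]].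
have K4 : (4 : K) != 0 by rewrite (natrM _ 2 2) mulf_neq0.
pose u := absolute_point a b.
have uu : hdot u u = 0 by exact: absolute_point_conic.
have u0 : u != 0.
  apply: contraNneq ab0 => /rowP e; move: (e 0) (e 2); rewrite !mxE /= => e0 e2.
  have a0 : a ^+ 2 = 0.
    by apply: (mulfI K2); rewrite mulr0 -[RHS]addr0 -{1}e0 -e2; ring.
  move: e0; rewrite a0 add0r => /eqP; rewrite sqrf_eq0 => /eqP ->.
  by move/eqP: a0; rewrite sqrf_eq0 => /eqP ->.
have hdot_u s t : hdot u (absolute_point s t) = - 2 * (b * s - a * t) ^+ 2.
  by rewrite hdotE !mxE /=; ring.
pose B := A - horocycle_form 0 (c / 4) u.
have BE s t : qform B (absolute_point s t) = 0.
  have -> : qform B (absolute_point s t) = qform A (absolute_point s t) -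
      qform (horocycle_form 0 (c / 4) u) (absolute_point s t).
    by rewrite /qform mulmxBr mulmxBl !mxE.
  by rewrite Hq qform_horocycle hdot_u; field.
have symB : B^T = B.
  by rewrite /B linearB /= symA horocycle_form_sym.
have BlamE : B = B 1 1 *: absolute K by exact: vanishing_on_absolute.
have AE : A = horocycle_form (B 1 1) (c / 4) u.
  by rewrite -[LHS](subrK (horocycle_form 0 (c / 4) u)) -/B {1}BlamE
    /horocycle_form scale0r add0r.
exists (B 1 1), (c / 4), u; split=> //; last by rewrite mulf_neq0 ?invr_eq0.
(* Without the multiple of [absolute K], the isotropic [u] would satisfy [u *m A = 0], although [A]
   is invertible. *)
apply: contraNneq u0 => lam0; rewrite -(mul_unit_eq0 _ unitA) AE lam0.
rewrite /horocycle_form scale0r add0r -scalemxAr trmx_mul absolute_sym !mulmxA.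
apply/eqP.
suff -> : u *m absolute K *m u^T = 0 by rewrite !mul0mx scaler0.
by apply/matrixP=> i j; rewrite !ord1 [RHS]mxE.
Qed.

(** * The given family, with contact point (1 : 0 : 1) *)

Lemma horocycle_mx_form lam :
  horocycle_mx lam = horocycle_form lam 1 (absolute_point 1 0).
Proof.
rewrite /horocycle_mx /horocycle_form scale1r.
suff <- : horocycle_tangent K = absolute_point 1 0 *m absolute K by [].
by apply: row3_inj; rewrite !mxE sum3 !mxE /= ?mulr1n ?mulr0n; ring.
Qed.

Lemma absolute_point10_neq0 : absolute_point 1 0 != 0 :> 'rV[K]_3.
Proof.
apply/eqP=> /rowP/(_ 0)/eqP; rewrite !mxE /= expr0n addr0 expr1n.
by rewrite oner_eq0.
Qed.

Lemma horocycle_mx_horocycle lam : lam != 0 -> horocycle (horocycle_mx lam).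
Proof.
move=> lam0; rewrite horocycle_mx_form; split.
  by apply: horocycle_form_regular => //; exact: absolute_point_conic.
(* On [absolute_point s t] the linear form x2 - x0 equals [- 2 * t ^+ 2], so the quartic is
   [4 * t ^+ 4]. *)
exists 1, 0, 4; split.
- by rewrite xpair_eqE oner_eq0.
- by rewrite (natrM _ 2 2) mulf_neq0.
move=> s t; rewrite qform_horocycle [X in _ * X]absolute_point_conic hdotE !mxE /=.
ring.
Qed.

Lemma fregier_locus_horocycle_mx lam : (5 : K) != 0 -> lam != 0 ->
  fregier_locus (horocycle_mx lam) =
    [set x : 'rV[K]_3 | x != 0 /\ lam * (x 0 1 ^+ 2 + x 0 2 ^+ 2 - x 0 0 ^+ 2)
       + 5 * (x 0 2 - x 0 0) ^+ 2 = 0] /\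
  fregier_locus (horocycle_mx lam) = conic (horocycle_mx (5^-1 * lam)).
Proof.
move=> K5 lam0; rewrite horocycle_mx_form fregier_locus_horocycle ?oner_eq0
  ?absolute_point10_neq0 //; last exact: absolute_point_conic.
have E x : qform (horocycle_form lam (5 * 1) (absolute_point 1 0)) x =
    lam * (x 0 1 ^+ 2 + x 0 2 ^+ 2 - x 0 0 ^+ 2) + 5 * (x 0 2 - x 0 0) ^+ 2.
  by rewrite qform_horocycle !hdotE !mxE /=; ring.
split; first by apply/seteqP; split=> x [x0 xE]; split=> //; rewrite -?E // E.
(* Dividing the equation by 5 shifts the factor from the doubled tangent to [lam]. *)
have E5 x : qform (horocycle_form lam (5 * 1) (absolute_point 1 0)) x =
    5 * qform (horocycle_mx (5^-1 * lam)) x.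
  by rewrite E horocycle_mxE; field.
apply/seteqP; split=> x [x0 xE]; split=> //; last by rewrite E5 xE mulr0.
by apply: (mulfI K5); rewrite -E5 xE mulr0.
Qed.

Lemma fregier_locus_nonsingular A : (3 : K) != 0 -> (5 : K) != 0 ->
  horocycle A -> ~ singular (fregier_locus A).
Proof.
move=> K3 K5 /(horocycle_formP K3)[lam [mu [u [lam0 mu0 u0 uu ->]]]]; apply.
exists (horocycle_form lam (5 * mu) u); split; first exact: horocycle_form_regular.
exact: fregier_locus_horocycle.
Qed.

End HorocycleLocus.

Theorem mainTheorem9 (R : realType) :
  (forall lambda : R, lambda != 0 ->
    [/\ horocycle (horocycle_mx lambda%:C),
        fregier_locus (horocycle_mx lambda%:C) =
          [set x : 'rV[R[i]]_3 | x != 0 /\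
             lambda%:C * (x 0 1 ^+ 2 + x 0 2 ^+ 2 - x 0 0 ^+ 2)
               + 5 * (x 0 2 - x 0 0) ^+ 2 = 0]
      & fregier_locus (horocycle_mx lambda%:C) =
          conic (horocycle_mx (5^-1 * lambda)%:C)]) /\
  (forall A : 'M[R[i]]_3, horocycle A -> ~ singular (fregier_locus A)).
Proof.
have nat_neq0 n : (n.+1%:R : R[i]) != 0 by rewrite Num.Theory.pnatr_eq0.
split=> [lambda lambda0|A]; last exact: fregier_locus_nonsingular.
have lam0 : lambda%:C != 0 by rewrite fmorph_eq0.
have [E1 E2] := fregier_locus_horocycle_mx (nat_neq0 1) (nat_neq0 4) lam0.
split; [exact: horocycle_mx_horocycle|exact: E1|].
have -> : (5^-1 * lambda)%:C = 5^-1 * lambda%:C.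
  by rewrite rmorphM fmorphV rmorph_nat.
exact: E2.
Qed.
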